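(* Let $K$ be a field and let $\phi:\mathfrak a\to\mathfrak b$ be a homomorphism of abelian Lie algebras over $K$ (not necessarily finite-dimensional). Suppose that $\operatorname{Im}(\phi)$ is finite-dimensional. Then $\operatorname{cd}(\phi)=\operatorname{rank}(\phi)=\dim_K(\operatorname{Im}\phi)$.
   Context: Modules over a Lie algebra $\mathfrak g$ over $K$ are left $\mathfrak g$-modules, equivalently left modules over the universal enveloping algebra $U(\mathfrak g)$ (no finiteness assumption; modules need not be trivial). $H^n(\mathfrak g,M)$ denotes Chevalley--Eilenberg cohomology (equivalently $\operatorname{Ext}^n_{U(\mathfrak g)}(K,M)$). For a Lie algebra homomorphism $\phi:\mathfrak g\to\mathfrak h$ and an $\mathfrak h$-module $M$, regarded as a $\mathfrak g$-module by restriction along $\phi$, there is an induced map $\phi^*:H^n(\mathfrak h,M)\to H^n(\mathfrak g,M)$ for each $n\ge 0$. The cohomological dimension of $\phi$ is $$\operatorname{cd}(\phi)=\sup\{n\ge 0:\ \text{there is an }\mathfrak h\text{-module }M\text{ with }\phi^*:H^n(\mathfrak h,M)\to H^n(\mathfrak g,M)\text{ nonzero}\}.$$ Here $\operatorname{rank}(\phi)$ is the rank of $\phi$ as a $K$-linear map. *)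

(* Defs.v *)
From HB Require Import structures.
From mathcomp Require Import all_boot all_order all_algebra.
From mathcomp Require Import boolp classical_sets functions constructive_ereal.
Set Implicit Arguments.
Unset Strict Implicit.
Unset Printing Implicit Defensive.
Import Order.TTheory GRing.Theory Num.Theory.
Local Open Scope classical_set_scope.
Local Open Scope ring_scope.
Local Open Scope quotient_scope.

HB.mixin Record isLieAlgebra (K : fieldType) L of GRing.Lmodule K L := {
  lie : L -> L -> L;
  lie_linearl : forall (c : K) (x y z : L),
    lie (c *: x + y) z = c *: lie x z + lie y z;
  lie_linearr : forall (c : K) (x y z : L),
    lie z (c *: x + y) = c *: lie z x + lie z y;
  liexx : forall x : L, lie x x = 0;
  lie_jacobi : forall x y z : L,
    lie x (lie y z) + lie y (lie z x) + lie z (lie x y) = 0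
}.

#[short(type="lieAlgType")]
HB.structure Definition LieAlgebra (K : fieldType) :=
  {L of isLieAlgebra K L & GRing.Lmodule K L}.

Definition lie_abelian (K : fieldType) (L : lieAlgType K) : Prop :=
  forall x y : L, lie x y = 0.

HB.mixin Record isLieMorphism (K : fieldType) (g h : lieAlgType K)
    (f : g -> h) := {
  lie_morph : forall x y : g, f (lie x y) = lie (f x) (f y)
}.

#[short(type="lieHom")]
HB.structure Definition LieMorphism (K : fieldType) (g h : lieAlgType K) :=
  {f of isLieMorphism K g h f & @GRing.Linear K g h *:%R f}.

HB.mixin Record isLieModule (K : fieldType) (g : lieAlgType K) M
    of GRing.Lmodule K M := {
  lact : g -> M -> M;
  lact_linearl : forall (c : K) (x y : g) (m : M),
    lact (c *: x + y) m = c *: lact x m + lact y m;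
  lact_linearr : forall (c : K) (x : g) (m m' : M),
    lact x (c *: m + m') = c *: lact x m + lact x m';
  lact_lie : forall (x y : g) (m : M),
    lact (lie x y) m = lact x (lact y m) - lact y (lact x m)
}.

#[short(type="lieModType")]
HB.structure Definition LieModule (K : fieldType) (g : lieAlgType K) :=
  {M of isLieModule K g M & GRing.Lmodule K M}.

Section Restriction.
Variables (K : fieldType) (g h : lieAlgType K).

Definition restrict_mod (phi : lieHom g h) (M : lieModType h) : Type := M.

Variables (phi : lieHom g h) (M : lieModType h).

HB.instance Definition _ := GRing.Lmodule.on (restrict_mod phi M).

Let act (x : g) (m : restrict_mod phi M) : restrict_mod phi M :=
  lact (phi x) (m : M).

Let act_linearl (c : K) (x y : g) (m : restrict_mod phi M) :
  act (c *: x + y) m = c *: act x m + act y m.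
Proof. by rewrite /act linearP lact_linearl. Qed.

Let act_linearr (c : K) (x : g) (m m' : restrict_mod phi M) :
  act x (c *: m + m') = c *: act x m + act x m'.
Proof. exact: lact_linearr. Qed.

Let act_lie (x y : g) (m : restrict_mod phi M) :
  act (lie x y) m = act x (act y m) - act y (act x m).
Proof. by rewrite /act lie_morph lact_lie. Qed.

HB.instance Definition _ := isLieModule.Build K g (restrict_mod phi M)
  act_linearl act_linearr act_lie.

End Restriction.

Section Cochains.
Variables (K : fieldType) (g : lieAlgType K) (M : lieModType g).

Definition multilinear n (f : ('I_n -> g) -> M) : Prop :=
  forall (x : 'I_n -> g) (i : 'I_n) (c : K) (u v : g),
    f [eta x with i |-> c *: u + v] =
      c *: f [eta x with i |-> u] + f [eta x with i |-> v].

Definition alternating n (f : ('I_n -> g) -> M) : Prop :=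
  forall (x : 'I_n -> g) (i j : 'I_n), i != j -> x i = x j -> f x = 0.

Definition cochain n (f : ('I_n -> g) -> M) : Prop :=
  multilinear f /\ alternating f.

(* For i < j, the family [x_i, x_j], x_0, ..., x_n with x_i and x_j omitted
   after the first entry: k |-> bump j (bump i k) enumerates the indices other
   than i and j, and all the values used here are at most n, so [inord] is
   harmless. *)
Definition bracket_family n (x : 'I_n.+1 -> g) (i j : 'I_n.+1) : 'I_n -> g :=
  fun k => if k == 0%N :> nat then lie (x i) (x j)
           else x (inord (bump j (bump i k.-1))).

Definition ce_diff n (f : ('I_n -> g) -> M) : ('I_n.+1 -> g) -> M := fun x =>
  \sum_(i < n.+1) (-1) ^+ i *: lact (x i) (f (x \o lift i)) +
  \sum_(i < n.+1) \sum_(j < n.+1 | (i < j)%N)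
    (-1) ^+ (i + j) *: f (bracket_family x i j).

Definition cocycle_pred n (f : ('I_n -> g) -> M) : bool :=
  `[< cochain f /\ ce_diff f = 0 >].

(* Not required to be a cocycle here, since this is only applied to cocycles;
   for n = 0 there are no cochains in degree n - 1. *)
Definition coboundary n : (('I_n -> g) -> M) -> Prop :=
  match n with
  | 0 => fun f => f = 0
  | n'.+1 => fun f => exists2 e : ('I_n' -> g) -> M, cochain e & f = ce_diff e
  end.

Lemma cochain_lin n (c : K) (f f' : ('I_n -> g) -> M) :
  cochain f -> cochain f' -> cochain (c *: f + f').
Proof.
move=> [mf af] [mf' af']; split=> [x i a u v|x i j nij xij].
  by rewrite addrfctE scalrfctE /= mf mf' !scalerDr !scalerA mulrC addrACA.
by rewrite addrfctE scalrfctE /= (af _ _ _ nij) // (af' _ _ _ nij) //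
  scaler0 addr0.
Qed.

Lemma cochain0 n : cochain (0 : ('I_n -> g) -> M).
Proof. by split=> [x i a u v|//]; rewrite scaler0 addr0. Qed.

Lemma ce_diff_is_linear n : linear (@ce_diff n).
Proof.
move=> c f f'; apply/funext => x; rewrite /ce_diff.
rewrite !addrfctE !scalrfctE /= scalerDr addrACA.
congr (_ + _); rewrite scaler_sumr -big_split /=; apply: eq_bigr => i _.
  by rewrite lact_linearr scalerDr !scalerA mulrC.
rewrite scaler_sumr -big_split /=; apply: eq_bigr => j _.
by rewrite scalerDr !scalerA mulrC.
Qed.

HB.instance Definition _ n :=
  GRing.isLinear.Build K _ _ _ (@ce_diff n) (@ce_diff_is_linear n).

Lemma cocycle_submod n : submod_closed (@cocycle_pred n).
Proof.
split=> [|c f f'].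
  by apply/asboolP; split; [exact: cochain0|rewrite linear0].
move=> /asboolP[Cf df] /asboolP[Cf' df']; apply/asboolP; split.
  exact: cochain_lin.
by rewrite ce_diff_is_linear df df' scaler0 addr0.
Qed.

HB.instance Definition _ n :=
  GRing.isSubmodClosed.Build K _ (@cocycle_pred n) (@cocycle_submod n).

Record cocycle n := Cocycle {
  cocycle_val :> ('I_n -> g) -> M;
  cocycleP : cocycle_val \in @cocycle_pred n
}.

HB.instance Definition _ n := [isSub for @cocycle_val n].
HB.instance Definition _ n := [Choice of cocycle n by <:].
HB.instance Definition _ n := [SubChoice_isSubLmodule of cocycle n by <:].

Definition coboundary_pred n (z : cocycle n) : bool := `[< coboundary z >].

Lemma coboundary_submod n : submod_closed (@coboundary_pred n).
Proof.
case: n => [|n]; split=> [|c z z']; rewrite ?inE.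
- by [].
- by move=> /= zE z'E; rewrite zE z'E scaler0 addr0.
- by exists 0; [exact: cochain0|rewrite linear0].
- move=> [e Ce zE] [e' Ce' z'E].
  by exists (c *: e + e'); [exact: cochain_lin|rewrite ce_diff_is_linear -zE -z'E].
Qed.

HB.instance Definition _ n :=
  GRing.isSubmodClosed.Build K _ (@coboundary_pred n) (@coboundary_submod n).

Definition coboundaries n : zmodClosed (cocycle n) :=
  GRing.ZmodClosed.clone _ (@coboundary_pred n) _.

Definition cohomology n : Type := Quotient.quot (coboundaries n).

HB.instance Definition _ n := GRing.Zmodule.on (cohomology n).
HB.instance Definition _ n := EqQuotient.on (cohomology n).
HB.instance Definition _ n : isZmodQuotient _
    (Quotient.equiv (coboundaries n)) 0 -%R +%R (cohomology n) :=
  ZmodQuotient.on (cohomology n).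

End Cochains.

Arguments cohomology {K} g M n.
Arguments cocycle {K} g M n.

Section InducedMap.
Variables (K : fieldType) (g h : lieAlgType K) (phi : lieHom g h).
Variables (M : lieModType h) (n : nat).

Definition pullback p (f : ('I_p -> h) -> M) : ('I_p -> g) -> restrict_mod phi M :=
  fun x => f (phi \o x).

Lemma pullback_cochain p (f : ('I_p -> h) -> M) :
  cochain f -> cochain (pullback f).
Proof.
have etaE q (x : 'I_q -> g) i u :
    phi \o [eta x with i |-> u] = [eta phi \o x with i |-> phi u].
  by apply/funext => k /=; case: ifP.
move=> [mf af]; split=> [x i c u v|x i j nij xij]; rewrite /pullback.
  by rewrite !etaE linearP mf.
by apply: (af _ _ _ nij); rewrite /= xij.
Qed.

Lemma ce_diff_pullback p (f : ('I_p -> h) -> M) :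
  ce_diff (pullback f) = pullback (ce_diff f).
Proof.
apply/funext => x; rewrite /ce_diff /pullback; congr (_ + _).
apply: eq_bigr => i _; apply: eq_bigr => j _; congr (_ *: f _).
apply/funext => k; rewrite /bracket_family /=.
by case: ifP => _; rewrite ?lie_morph.
Qed.

Lemma pullback_cocycleP (z : cocycle h M n) :
  pullback z \in @cocycle_pred _ g (restrict_mod phi M) n.
Proof.
have /asboolP[Cz dz] := cocycleP z; apply/asboolP; split.
  exact: pullback_cochain.
by rewrite ce_diff_pullback dz.
Qed.

Definition pullback_cocycle (z : cocycle h M n) :
  cocycle g (restrict_mod phi M) n := Cocycle (pullback_cocycleP z).

Lemma pullback_cocycle_is_zmod_morphism : zmod_morphism pullback_cocycle.
Proof. by move=> z z'; exact: val_inj. Qed.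

HB.instance Definition _ := GRing.isZmodMorphism.Build _ _ pullback_cocycle
  pullback_cocycle_is_zmod_morphism.

Lemma pullback_coboundary (z : cocycle h M n) :
  z \in coboundaries M n ->
  pullback_cocycle z \in coboundaries (restrict_mod phi M) n.
Proof.
move=> /asboolP Bz; apply/asboolP; rewrite /= {1}/pullback.
case: n z Bz => [|p] z /=; first by move=> ->.
move=> [e Ce ->]; exists (pullback e); first exact: pullback_cochain.
by rewrite ce_diff_pullback.
Qed.

Definition cohomology_map :
    cohomology h M n -> cohomology g (restrict_mod phi M) n :=
  fun c => \pi_(cohomology g (restrict_mod phi M) n) (pullback_cocycle (repr c)).

Lemma cohomology_map_pi (z : cocycle h M n) :
  cohomology_map (\pi_(cohomology h M n) z) =
    \pi_(cohomology g (restrict_mod phi M) n) (pullback_cocycle z).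
Proof.
rewrite /cohomology_map; apply/eqP; rewrite -Quotient.idealrBE -raddfB.
by apply: pullback_coboundary; rewrite Quotient.idealrBE reprK.
Qed.

Lemma cohomology_map_is_zmod_morphism : zmod_morphism cohomology_map.
Proof.
move=> c c'; rewrite -[c]reprK -[c']reprK -raddfB !cohomology_map_pi.
by rewrite !raddfB.
Qed.

HB.instance Definition _ := GRing.isZmodMorphism.Build _ _ cohomology_map
  cohomology_map_is_zmod_morphism.

End InducedMap.

Definition cohomology_map_nonzero (K : fieldType) (g h : lieAlgType K)
    (phi : lieHom g h) (n : nat) : Prop :=
  exists (M : lieModType h) (c : cohomology h M n), cohomology_map phi c != 0.

(* The values lie in N \cup {+oo}, embedded in \bar int. *)
Definition lie_cd (K : fieldType) (g h : lieAlgType K) (phi : lieHom g h) :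
    \bar int :=
  supremum 0%:E [set n%:Z%:E | n in cohomology_map_nonzero phi].

Section Dimension.
Variables (K : fieldType) (V : lmodType K).

Definition lin_span n (e : 'I_n -> V) : set V :=
  [set \sum_(i < n) c i *: e i | c in [set: 'I_n -> K]].

Definition lin_free n (e : 'I_n -> V) : Prop :=
  forall c : 'I_n -> K, \sum_(i < n) c i *: e i = 0 -> forall i, c i = 0.

Definition is_basis (W : set V) n (e : 'I_n -> V) : Prop :=
  lin_free e /\ lin_span e = W.

Definition finite_dim (W : set V) : Prop :=
  exists n (e : 'I_n -> V), lin_span e = W.

(* Meant for linear subspaces; +oo if there is no finite basis. *)
Definition lin_dim (W : set V) : \bar int :=
  xget +oo%E [set n%:Z%:E | n in [set n | exists e : 'I_n -> V, is_basis W e]].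

End Dimension.

Definition lin_rank (K : fieldType) (U V : lmodType K) (f : {linear U -> V}) :
    \bar int := lin_dim (range f).

(* Main.v *)
(* An alternating form pulled back along phi only sees the image of phi, so it
   vanishes in degrees above the dimension r of that image: cd(phi) <= r holds
   already at the level of cochains.  Conversely, with trivial coefficients all
   differentials of an abelian Lie algebra are zero, hence cohomology classes
   are alternating forms; extending the dual basis of the image to linear
   functionals on b, their determinant is a class of degree r whose pullback
   does not vanish.  That the dimension of the image is well defined comes for
   free, since cd(phi) equals the size of any of its bases. *)
Require Import Defs.
From HB Require Import structures.
From mathcomp Require Import all_boot all_order all_algebra.
From mathcomp Require Import boolp classical_sets functions constructive_ereal.
Set Implicit Arguments.
Unset Strict Implicit.
Unset Printing Implicit Defensive.
Import Order.TTheory GRing.Theory Num.Theory.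
Local Open Scope classical_set_scope.
Local Open Scope ring_scope.

(** * Linear algebra in arbitrary dimension: bases, complements, dual functionals *)

Section LinearAlgebra.
Variables (K : fieldType) (V : lmodType K).

Lemma lin_span_vec n (e : 'I_n -> V) (i : 'I_n) : lin_span e (e i).
Proof.
exists (fun j => (j == i)%:R) => //=.
rewrite (bigD1 i) //= eqxx scale1r big1 ?addr0 // => j /negPf->.
exact: scale0r.
Qed.

Lemma lin_span_drop n (e : 'I_n.+1 -> V) (c : 'I_n.+1 -> K) (i : 'I_n.+1) :
  \sum_(j < n.+1) c j *: e j = 0 -> c i != 0 ->
  lin_span (e \o lift i) = lin_span e.
Proof.
move=> ce0 ci; rewrite predeqE => v; split=> [[d _ <-]|[d _ <-]].
  exists (fun j => if unlift i j is Some k then d k else 0) => //=.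
  rewrite (bigD1_ord i) //= unlift_none scale0r add0r.
  by apply: eq_bigr => k _; rewrite liftK.
(* These coefficients come from solving the relation for [e i] and substituting the result. *)
exists (fun k => d (lift i k) - d i / c i * c (lift i k)) => //=.
have eiE : e i = - (c i)^-1 *: \sum_k c (lift i k) *: e (lift i k).
  move: ce0; rewrite (bigD1_ord i) //= => /eqP.
  rewrite addrC addr_eq0 => /eqP->.
  by rewrite scalerN scaleNr opprK scalerA mulVf // scale1r.
rewrite [RHS](bigD1_ord i) //= eiE scalerA scaler_sumr -big_split /=.
apply: eq_bigr => k _.
by rewrite scalerA -scalerDl addrC mulrN mulNr.
Qed.

(** A spanning family of least length is free: a nontrivial relation would allow one vector to be
    dropped. *)
Lemma finite_dim_basis (W : set V) :
  finite_dim W -> exists n (e : 'I_n -> V), is_basis W e.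
Proof.
move=> finW; have exW : exists n, `[< exists e : 'I_n -> V, lin_span e = W >].
  by case: finW => n eW; exists n; apply/asboolP.
case: (ex_minnP exW) => n /asboolP[e eW] nmin.
exists n, e; split=> // c ce0 i; apply: contrapT => /eqP ci.
case: n e eW nmin c ce0 i ci => [|n] e eW nmin c ce0 i ci; first by case: i ci.
suff /nmin : `[< exists e' : 'I_n -> V, lin_span e' = W >] by rewrite ltnn.
by apply/asboolP; exists (e \o lift i); rewrite (lin_span_drop ce0 ci).
Qed.

(* A subspace maximal among those meeting the span of [e] trivially is a
   complement of that span. *)
Lemma span_complement n (e : 'I_n -> V) :
  exists W : set V,
    [/\ forall c x y, W x -> W y -> W (c *: x + y),
        W `&` lin_span e `<=` [set 0] &
        forall v, exists w c, W w /\ v = w + \sum_(i < n) c i *: e i].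
Proof.
(* [P] does not ask for [0], so that the union of the empty chain satisfies it too. *)
pose P (W : set V) := (forall c x y, W x -> W y -> W (c *: x + y)) /\
  W `&` lin_span e `<=` [set 0].
have [|W [[Wlin We] Wmax]] := @Zorn_bigcup _ P.
  move=> F FP Ftot; split=> [c x y [X FX Xx] [Y FY Yy]|x [[X FX Xx] ex]].
    have [XY|YX] := Ftot _ _ FX FY.
      by exists Y => //; apply: (FP _ FY).1 => //; exact: XY.
    by exists X => //; apply: (FP _ FX).1 => //; exact: YX.
  exact: (FP _ FX).2.
(* If [W] missed [0] it would be empty, hence strictly below [[set 0]], against maximality. *)
have W0 : W 0.
  apply: contrapT => nW0.
  apply: (Wmax [set 0]); last first.
    by split=> [c x y -> ->|x []//]; rewrite /= scaler0 addr0.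
  split=> [x Wx|/(_ 0 erefl)//].
  by case: nW0; rewrite -(addNr x) -scaleN1r; exact: Wlin.
exists W; split=> // v; apply: contrapT => nv.
pose B := [set w + c *: v | w in W & c in [set: K]].
apply: (Wmax B).
  split=> [w Ww|/(_ v)]; first by exists w => //; exists 0; rewrite // scale0r addr0.
  have Bv : B v by exists 0 => //; exists 1; rewrite ?scale1r ?add0r.
  move=> /(_ Bv) Wv; apply: nv; exists v, (fun=> 0); split=> //.
  by rewrite big1 ?addr0 // => i _; rewrite scale0r.
split=> [c _ _ [w Ww [d _ <-]] [w' Ww' [d' _ <-]]|_ [[w Ww [c _ <-]] [d _ dE]]].
  exists (c *: w + w'); first exact: Wlin.
  by exists (c * d + d'); rewrite // scalerDr scalerA scalerDl addrACA.
have [c0|c0] := eqVneq c 0.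
  apply: We; split; last by exists d.
  by rewrite c0 scale0r addr0.
(* With [c] invertible, [dE] is solved for [v], which therefore decomposes after all. *)
case: nv; exists (- c^-1 *: w), (fun i => c^-1 * d i); split.
  by rewrite -[_ *: w]addr0; exact: Wlin.
under eq_bigr do rewrite -scalerA.
by rewrite -scaler_sumr dE scalerDr addrA scaleNr addNr add0r scalerA mulVf //
  scale1r.
Qed.

(** The functionals read off the coordinates along [e] modulo a complement of its span. They are
    linear because these coordinates are unique. *)
Lemma lin_free_dual n (e : 'I_n -> V) : lin_free e ->
  exists d : V -> 'I_n -> K,
    (forall c x y i, d (c *: x + y) i = c * d x i + d y i) /\
    (forall i j, d (e i) j = (i == j)%:R).
Proof.
move=> efree; have [W [Wlin We dec]] := span_complement e.
have W0 : W 0.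
  by have [w [_ [Ww _]]] := dec 0; rewrite -(addNr w) -scaleN1r; exact: Wlin.
have Wuniq w w' c c' : W w -> W w' ->
    w + \sum_(i < n) c i *: e i = w' + \sum_(i < n) c' i *: e i -> c =1 c'.
  move=> Ww Ww' eq_ww'.
  have sumE : \sum_(i < n) (c i - c' i) *: e i = w' - w.
    under eq_bigr do rewrite scalerBl.
    by rewrite sumrB -[X in X - _](addKr w) eq_ww' addrA addrK addrC.
  have ww' : w' - w = 0.
    apply: We; split; last by exists (fun i => c i - c' i).
    by rewrite addrC -scaleN1r; exact: Wlin.
  by move: sumE; rewrite ww' => /efree cc' i; apply/eqP; rewrite -subr_eq0 cc'.
have /choice[d dP] v : exists c, exists w, W w /\ v = w + \sum_(i < n) c i *: e i.
  by have [w [c ?]] := dec v; exists c, w.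
exists d; split=> [c x y i|i j].
  have [w [Ww wE]] := dP (c *: x + y).
  have [wx [Wx xE]] := dP x; have [wy [Wy yE]] := dP y.
  apply: (Wuniq w (c *: wx + wy) _ (fun i => c * d x i + d y i)) => //.
    exact: Wlin.
  rewrite -wE {1}xE {1}yE scalerDr addrACA; congr (_ + _).
  rewrite scaler_sumr -big_split; apply: eq_bigr => k _ /=.
  by rewrite scalerDl scalerA.
have [w [Ww wE]] := dP (e i).
apply: (Wuniq w 0 _ (fun j => (i == j)%:R)) => //.
rewrite -wE add0r (bigD1 i) //= eqxx scale1r big1 ?addr0 // => k ki.
by rewrite eq_sym (negPf ki) scale0r.
Qed.

End LinearAlgebra.

(** * Vanishing of alternating forms and of differentials *)

Section AlternatingForms.
Variables (K : fieldType) (g : lieAlgType K) (M : lieModType g).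

Lemma multilinear_sum m (f : ('I_m -> g) -> M) (x : 'I_m -> g) (i : 'I_m) n
    (c : 'I_n -> K) (u : 'I_n -> g) : multilinear f ->
  f [eta x with i |-> \sum_(j < n) c j *: u j] =
    \sum_(j < n) c j *: f [eta x with i |-> u j].
Proof.
move=> mf; have f0 : f [eta x with i |-> 0] = 0.
  by have := mf x i (- 1) 0 0; rewrite scaler0 addr0 scaleN1r addNr.
apply: (big_ind2 (fun s t => f [eta x with i |-> s] = t)) =>
  //= [s1 t1 s2 t2 <- <-|j _].
  by rewrite -[X in X + s2]scale1r mf scale1r.
by rewrite -[c j *: u j]addr0 mf f0 addr0.
Qed.

Lemma multilinear_zero_arg m (f : ('I_m -> g) -> M) (x : 'I_m -> g) (i : 'I_m) :
  multilinear f -> x i = 0 -> f x = 0.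
Proof.
move=> mf xi0; have -> : x = [eta x with i |-> \sum_(j < 0) 0 *: 0].
  by apply/funext => j /=; case: eqP => [->|//]; rewrite big_ord0.
by rewrite multilinear_sum // big_ord0.
Qed.

(** Expanding every argument by multilinearity leaves values of [f] on vectors of [e] only; as
    [n < m], two arguments then coincide. *)
Lemma alternating_vanish n m (e : 'I_n -> g) (f : ('I_m -> g) -> M)
    (x : 'I_m -> g) :
  (n < m)%N -> cochain f -> (forall i, lin_span e (x i)) -> f x = 0.
Proof.
move=> nm [mf af].
(* Arguments of index at least [k] are already vectors of [e]. The case [k = 0] is the pigeonhole
   principle; the induction step expands the argument of index [k]. *)
suff H k : (k <= m)%N -> forall x : 'I_m -> g, (forall i, lin_span e (x i)) ->
    (forall i : 'I_m, (k <= i)%N -> exists j, x i = e j) -> f x = 0.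
  by move=> xe; apply: (H m) => // i; rewrite leqNgt ltn_ord.
elim: k => [_ {}x _ xP|k IH km {}x xe xP].
  have /choice[s sP] i : exists j, x i = e j by exact: xP.
  have /injectivePn[i [j ij sij]] : ~~ injectiveb s.
    apply/negP => /injectiveP /leq_card; rewrite !card_ord.
    by rewrite leqNgt nm.
  by apply: (af _ i j) => //; rewrite !sP sij.
pose i := Ordinal km; have [c _ cE] := xe i.
have -> : x = [eta x with i |-> \sum_(j < n) c j *: e j].
  by apply/funext => j /=; case: eqP => [->|].
rewrite multilinear_sum // big1 // => j _.
rewrite IH ?scaler0 1?ltnW // => l /=.
  by case: ifP => // _; exact: lin_span_vec.
case: eqP => [_ _|li kl]; first by exists j.
apply: xP; rewrite ltn_neqAle kl andbT; apply/eqP => kl'.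
by apply: li; exact: val_inj.
Qed.

(** The first sum dies with the action, and each term of the second has a bracket, hence [0], as its
    first argument. *)
Lemma ce_diff_trivial n (f : ('I_n -> g) -> M) :
  lie_abelian g -> (forall (x : g) (m : M), lact x m = 0) -> multilinear f ->
  ce_diff f = 0.
Proof.
move=> gab M0 mf; apply/funext => x; rewrite /ce_diff.
rewrite big1 ?add0r => [|i _]; last by rewrite M0 scaler0.
rewrite big1 // => i _; rewrite big1 // => j ij.
(* For [n = 0] there is no first argument, but also no pair [i < j] in ['I_1]. *)
case: n f mf x i j ij => [|n] f mf x i j ij.
  by move: ij; rewrite (ord1 i) (ord1 j).
by rewrite (multilinear_zero_arg (i := ord0)) ?scaler0 // /bracket_family /= gab.
Qed.

End AlternatingForms.

(** * Determinant cochains with trivial coefficients *)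

Definition trivial_module (K : fieldType) (g : lieAlgType K) : Type := K^o.

Section TrivialModule.
Variables (K : fieldType) (g : lieAlgType K).

HB.instance Definition _ := GRing.Lmodule.on (trivial_module g).

Let act (x : g) (m : trivial_module g) : trivial_module g := 0.

Let act_linearl (c : K) (x y : g) (m : trivial_module g) :
  act (c *: x + y) m = c *: act x m + act y m.
Proof. by rewrite scaler0 addr0. Qed.

Let act_linearr (c : K) (x : g) (m m' : trivial_module g) :
  act x (c *: m + m') = c *: act x m + act x m'.
Proof. by rewrite scaler0 addr0. Qed.

Let act_lie (x y : g) (m : trivial_module g) :
  act (lie x y) m = act x (act y m) - act y (act x m).
Proof. by rewrite subr0. Qed.

HB.instance Definition _ := isLieModule.Build K g (trivial_module g)
  act_linearl act_linearr act_lie.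

(** For linear [d], this is the wedge product of its [n] component functionals. *)
Definition coord_det n (d : g -> 'I_n -> K) (x : 'I_n -> g) :
  trivial_module g := \det (\matrix_(i, j) d (x i) j).

Lemma coord_det_cochain n (d : g -> 'I_n -> K) :
  (forall c x y i, d (c *: x + y) i = c * d x i + d y i) ->
  cochain (coord_det d).
Proof.
move=> dlin; split=> [x i c u v|x i j ij xij]; last first.
  by apply: (determinant_alternate ij) => k; rewrite !mxE xij.
rewrite -[coord_det d [eta x with i |-> v]]mul1r.
apply: (determinant_multilinear (i0 := i)).
- by apply/rowP => j; rewrite !mxE /= !eqxx dlin mul1r.
- by apply/matrixP => k j; rewrite !mxE /= eq_sym (negPf (neq_lift _ _)).
- by apply/matrixP => k j; rewrite !mxE /= eq_sym (negPf (neq_lift _ _)).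
Qed.

End TrivialModule.

(** * Both bounds on the cohomological dimension, and the rank *)

Section CohomologicalDimension.
Local Open Scope quotient_scope.
Variables (K : fieldType) (a b : lieAlgType K) (phi : lieHom a b).

Lemma cohomology_map_nonzero_le n (e : 'I_n -> b) m :
  range phi `<=` lin_span e -> cohomology_map_nonzero phi m -> (m <= n)%N.
Proof.
move=> phie [M [c]]; rewrite leqNgt; apply: contra => nm; apply/eqP.
rewrite /cohomology_map; suff -> : pullback_cocycle phi (repr c) = 0.
  by rewrite raddf0.
apply/val_inj/funext => x /=; rewrite /pullback.
have /asboolP[Cc _] := cocycleP (repr c).
by apply: (alternating_vanish nm Cc) => i; apply: phie; exists (x i).
Qed.

Lemma cohomology_map_nonzero_free n (e : 'I_n -> b) :
  lie_abelian a -> lie_abelian b -> lin_free e -> lin_span e `<=` range phi ->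
  cohomology_map_nonzero phi n.
Proof.
move=> aab bab /lin_free_dual[d [dlin dE]] ephi.
have Cd := coord_det_cochain dlin.
have zP : coord_det d \in @cocycle_pred _ _ (trivial_module b) n.
  by apply/asboolP; split=> //; apply: ce_diff_trivial Cd.1.
exists (trivial_module b),
  (\pi_(cohomology b (trivial_module b) n) (Cocycle zP)).
rewrite cohomology_map_pi.
rewrite -(raddf0 (\pi_(cohomology a (restrict_mod phi (trivial_module b)) n))).
rewrite -Quotient.idealrBE subr0; apply/negP => /asboolP.
(* At preimages of the [e i], the coordinate matrix is the identity, so the pulled-back form takes
   the value 1. *)
have /choice[x xE] i : exists x, phi x = e i.
  by have [x _] := ephi _ (lin_span_vec e i); exists x.
have z0 : pullback phi (coord_det d) <> 0.
  move=> /(congr1 (fun f => f x)); rewrite /pullback /coord_det.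
  suff -> : \matrix_(i, j) d ((phi \o x) i) j = 1%:M.
    by rewrite det1 => /eqP; rewrite oner_eq0.
  by apply/matrixP => i j; rewrite !mxE /= xE dE.
(* In degree 0 a coboundary is zero by definition; in positive degree it is a differential, which
   vanishes since [a] is abelian and acts trivially on the restricted module. *)
case: n e d dlin dE ephi Cd zP x xE z0 => [|n] e d dlin dE ephi Cd zP x xE z0 //=.
move=> [f Cf fE]; apply: z0; rewrite fE.
by apply: ce_diff_trivial Cf.1.
Qed.

Lemma lie_cd_basis n (e : 'I_n -> b) :
  lie_abelian a -> lie_abelian b -> is_basis (range phi) e ->
  lie_cd phi = n%:Z%:E.
Proof.
move=> aab bab [efree espan]; rewrite /lie_cd /supremum.
have nz : cohomology_map_nonzero phi n.
  by apply: (cohomology_map_nonzero_free aab bab efree); rewrite espan.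
(* The default value of [supremum] is ruled out: the set contains [n]. *)
rewrite ifF; last by apply/negbTE/set0P; exists n%:Z%:E, n.
apply: xget_subset1; last exact: is_subset1_supremums.
split=> [_ [m mnz <-]|y]; last by apply; exists n.
rewrite lee_fin lez_nat; apply: (cohomology_map_nonzero_le (e := e)) mnz.
by rewrite espan.
Qed.

(** [xget] may pick the length of any basis, but each such length equals [lie_cd phi]. *)
Lemma lin_rank_basis n (e : 'I_n -> b) :
  lie_abelian a -> lie_abelian b -> is_basis (range phi) e ->
  lin_rank phi = n%:Z%:E.
Proof.
move=> aab bab eP; apply: xget_unique; first by exists n => //; exists e.
move=> _ [m [e' e'P] <-].
by rewrite -(lie_cd_basis aab bab e'P) -(lie_cd_basis aab bab eP).
Qed.

End CohomologicalDimension.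

Theorem theorem5p3 (K : fieldType) (a b : lieAlgType K) (phi : lieHom a b)
    (a_abelian : lie_abelian a) (b_abelian : lie_abelian b)
    (im_fin : finite_dim (range phi)) :
  lie_cd phi = lin_rank phi /\ lin_rank phi = lin_dim (range phi).
Proof.
split=> //; have [n [e eP]] := finite_dim_basis im_fin.
by rewrite (lie_cd_basis a_abelian b_abelian eP)
  (lin_rank_basis a_abelian b_abelian eP).
Qed.
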